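(* Let $G$ and $H$ be rooted digraphs and let $\phi$ be a robust map from $G$ to $H$. If Angel wins the Angel-Devil game on $H$, then Angel wins the Angel-Devil game on $G$.
   Context: A rooted digraph is a digraph (loops allowed) with a designated root vertex. If $G,H$ have roots $g_0,h_0$, a robust map from $G$ to $H$ is a map $\phi:V(G)\to V(H)$ with $\phi(g_0)=h_0$ such that whenever $\phi(v)\to w$ is an edge of $H$, there is a vertex $z$ of $G$ with $\phi(z)=w$ and $v\to z$ an edge of $G$. The Angel-Devil game on a rooted digraph: vertices start unburned; Angel starts at the root; players alternate, Angel first; Angel moves from his current vertex to an unburned out-neighbor, and Devil burns at most one vertex per turn (permanently). Devil wins if Angel is ever unable to move; Angel wins if he has a strategy to move forever. *)

(* Defs.v *)
From Stdlib Require Import List.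

Set Implicit Arguments.
Unset Strict Implicit.

(* No finiteness assumption is made on the vertices. *)
Record rooted_digraph : Type := RootedDigraph {
  vertex :> Type;
  edge : vertex -> vertex -> Prop;
  root : vertex
}.

Arguments edge {_} _ _.
Arguments root {_}.

Definition robust_map (G H : rooted_digraph) (phi : G -> H) : Prop :=
  phi root = root /\
  forall (v : G) (w : H),
    edge (phi v) w -> exists z : G, phi z = w /\ edge v z.

Section Game.

Variable G : rooted_digraph.

(* The completed rounds, most recent first.  A round [(v, b)] is Angel's move
   to [v] followed by Devil's turn, where [b = Some u] burns [u] and [b = None]
   burns nothing.  Devil may burn any vertex, including the one Angel occupies;
   burning a burned vertex again has no effect. *)
Definition history : Type := list (G * option G).

Definition position (h : history) : G :=
  match h with
  | nil => root
  | (v, _) :: _ => v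
  end.

Definition burned (h : history) (v : G) : Prop :=
  In (Some v) (map snd h).

Definition legal_move (h : history) (w : G) : Prop :=
  edge (position h) w /\ ~ burned h w.

(* Strategies may use the full history, and are total: they also have a
   (possibly illegal) value where Angel is stuck. *)
Definition angel_strategy : Type := history -> G.

(* The first [n] rounds when Angel follows [s] and Devil's turns are [d]. *)
Fixpoint play (s : angel_strategy) (d : nat -> option G) (n : nat) : history :=
  match n with
  | O => nil
  | S m => (s (play s d m), d m) :: play s d m
  end.

Definition angel_wins : Prop :=
  exists s : angel_strategy,
    forall (d : nat -> option G) (n : nat),
      legal_move (play s d n) (s (play s d n)).

End Game.

(* Main.v *)
(** Angel on [G] plays a winning strategy of [H] on the image of the play under
    [phi], treating each vertex burned by Devil as if its image were burned, and
    lifts the prescribed move along [phi] by robustness.  The lifted vertex is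
    unburned because otherwise its image would be burned. *)

Require Import Defs.
From Stdlib Require Import List ClassicalEpsilon.

Definition map_history (G H : rooted_digraph) (phi : G -> H) (h : history G) :
    history H :=
  map (fun r => (phi (fst r), option_map phi (snd r))) h.

Lemma position_map_history (G H : rooted_digraph) (phi : G -> H) (h : history G) :
  phi root = root -> position (map_history G H phi h) = phi (position h).
Proof. now destruct h as [|[v b] h]. Qed.

(** The converse can fail: if [phi] identifies vertices, burning one of them burns the image of
    all. *)
Lemma burned_map_history (G H : rooted_digraph) (phi : G -> H) (h : history G)
    (v : G) :
  burned h v -> burned (map_history G H phi h) (phi v).
Proof.
  unfold burned, map_history; intros Hv.
  apply in_map_iff in Hv as [r [Er Hr]].
  rewrite map_map; apply in_map_iff.
  exists r; split; [simpl; now rewrite Er | exact Hr].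
Qed.

(** Strategies are total, but a lift need not exist at every history: [epsilon] picks a lift if
    there is one, and some arbitrary vertex otherwise. *)
Definition lifted_strategy (G H : rooted_digraph) (phi : G -> H)
    (s : angel_strategy H) : angel_strategy G :=
  fun h => epsilon (inhabits root)
    (fun z => phi z = s (map_history G H phi h) /\ edge (position h) z).

Lemma lifted_strategy_spec (G H : rooted_digraph) (phi : G -> H)
    (s : angel_strategy H) (h : history G) :
  robust_map phi ->
  legal_move (map_history G H phi h) (s (map_history G H phi h)) ->
  phi (lifted_strategy G H phi s h) = s (map_history G H phi h) /\
  legal_move h (lifted_strategy G H phi s h).
Proof.
  intros [phi_root phi_lift] [Hedge Hunburned].
  rewrite position_map_history in Hedge by exact phi_root.
  (* Robustness gives the existence of a lift that [epsilon_spec] requires. *)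
  pose proof (epsilon_spec (inhabits root) _ (phi_lift _ _ Hedge))
    as [Hphi Hz].
  fold (lifted_strategy G H phi s h) in Hphi, Hz.
  split; [exact Hphi | split; [exact Hz |]].
  intros Hb; apply Hunburned; rewrite <- Hphi.
  now apply burned_map_history.
Qed.

(** By induction, the image so far is a play of [s], so the next move of [s] is legal there and
    therefore lifts. *)
Lemma map_history_play (G H : rooted_digraph) (phi : G -> H)
    (s : angel_strategy H) (d : nat -> option G) (n : nat) :
  robust_map phi ->
  (forall d' m, legal_move (play s d' m) (s (play s d' m))) ->
  map_history G H phi (play (lifted_strategy G H phi s) d n) =
  play s (fun m => option_map phi (d m)) n.
Proof.
  intros phi_robust s_wins; induction n as [|n IH]; [reflexivity |].
  simpl; rewrite <- IH; f_equal; f_equal.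
  apply lifted_strategy_spec; [exact phi_robust |].
  rewrite IH; apply s_wins.
Qed.

Theorem theorem9 (G H : rooted_digraph) (phi : G -> H)
    (phi_robust : robust_map phi) (H_win : angel_wins H) :
  angel_wins G.
Proof.
  destruct H_win as [s s_wins].
  exists (lifted_strategy G H phi s); intros d n.
  apply lifted_strategy_spec; [exact phi_robust |].
  rewrite map_history_play by assumption; apply s_wins.
Qed.
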